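(* Let $\mathfrak{B}$ be a bornology on a metric space $X$ with a closed base $\mathfrak{B}_0$ and let $\mathcal{I},\mathcal{J}$ be ideals on $\omega$. The following statements hold. (1) If $|\mathfrak{B}_0|<\mathrm{sl}_e(\mathcal{I},\mathcal{J})$, then $X$ satisfies $\mathrm{S}_1(\mathcal{I}\text{-}\Gamma_{\mathfrak{B}^s},\mathcal{J}\text{-}\Gamma_{\mathfrak{B}^s})$. (2) If $|\mathfrak{B}_0|<\mathrm{sl}_e(\ast,\mathcal{J})$, then $X$ satisfies $\mathrm{S}_1(\mathcal{O}_{\mathfrak{B}^s},\mathcal{J}\text{-}\Gamma_{\mathfrak{B}^s})$, provided $X$ is $\mathfrak{B}^s$-Lindelöf. (3) If $|\mathfrak{B}_0|<\mathrm{sl}_t(\mathcal{I},\mathrm{Fin})$, then $X$ satisfies $\mathrm{S}_1(\mathcal{I}\text{-}\Gamma_{\mathfrak{B}^s},\mathcal{O}_{\mathfrak{B}^s})$. (4) If $|\mathfrak{B}_0|<\mathrm{sl}_t(\ast,\mathrm{Fin})$, then $X$ satisfies $\mathrm{S}_1(\mathcal{O}_{\mathfrak{B}^s},\mathcal{O}_{\mathfrak{B}^s})$, provided $X$ is $\mathfrak{B}^s$-Lindelöf.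
   Context: $(X,d)$ is an infinite metric space; $\omega$ is the set of natural numbers. A bornology $\mathfrak{B}$ on $X$ is a family of subsets of $X$ that is closed under subsets and finite unions and covers $X$. A base of $\mathfrak{B}$ is a subfamily $\mathfrak{B}_0\subseteq\mathfrak{B}$ such that every $B\in\mathfrak{B}$ is contained in some $B_0\in\mathfrak{B}_0$; it is a closed base if its members are closed. For $B\in\mathfrak{B}$, $\delta>0$: $B^\delta=\bigcup_{x\in B}\{y\in X:d(x,y)<\delta\}$. An ideal on $\omega$ is a family $\mathcal{I}\subseteq\mathcal{P}(\omega)$ closed under subsets and finite unions, containing all finite sets, with $\omega\notin\mathcal{I}$. $\mathrm{Fin}$ is the ideal of finite sets; $\mathcal{J}^+=\mathcal{P}(\omega)\setminus\mathcal{J}$; $\mathcal{J}^\ast=\{\omega\setminus A:A\in\mathcal{J}\}$. Covers of $X$ never contain $X$ as an element. A cover $\mathcal{U}$ of $X$ is a $\mathfrak{B}^s$-cover if for each $B\in\mathfrak{B}$ there are $U\in\mathcal{U}$ and $\delta>0$ with $B^\delta\subseteq U$; it is an open $\mathfrak{B}^s$-cover if its members are open. $\mathcal{O}_{\mathfrak{B}^s}$ is the class of open $\mathfrak{B}^s$-covers of $X$. $X$ is $\mathfrak{B}^s$-Lindelöf if every $\mathfrak{B}^s$-cover of $X$ contains a countable subset which is a $\mathfrak{B}^s$-cover of $X$. A countable open cover $\{U_n:n\in\omega\}$ (with its enumeration) is an $\mathcal{I}$-$\gamma_{\mathfrak{B}^s}$-cover if for each $B\in\mathfrak{B}$ there is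 a sequence $\{\delta_n\}$ of positive reals with $\{n\in\omega:B^{\delta_n}\nsubseteq U_n\}\in\mathcal{I}$; $\mathcal{I}\text{-}\Gamma_{\mathfrak{B}^s}$ is the class of these. $\mathrm{S}_1(\mathcal{A},\mathcal{B})$: for every sequence $\{A_n:n\in\omega\}$ of elements of $\mathcal{A}$ there are $a_n\in A_n$ ($n\in\omega$) such that $\{a_n:n\in\omega\}\in\mathcal{B}$ (for enumerated covers, with the enumeration $n\mapsto a_n$). A family $\mathcal{A}\subseteq\mathcal{P}(\omega)$ has the finite union property if $\omega\setminus\bigcup_{i=1}^kA_i$ is infinite for all $A_1,\dots,A_k\in\mathcal{A}$. A family $\mathcal{S}\subseteq{}^\omega\mathcal{P}(\omega)$ (of slaloms) has FUPC if for each $n\in\omega$ the family $\{s(n):s\in\mathcal{S}\}$ has the finite union property. Then: $\mathrm{sl}_e(\mathcal{I},\mathcal{J})$ is the minimum of $|\mathcal{S}|$ over $\mathcal{S}\subseteq{}^\omega\mathcal{I}$ such that for every $\phi\in{}^\omega\omega$ there is $s\in\mathcal{S}$ with $\{n:\phi(n)\in s(n)\}\in\mathcal{J}^+$; $\mathrm{sl}_t(\mathcal{I},\mathcal{J})$ is the minimum of $|\mathcal{S}|$ over $\mathcal{S}\subseteq{}^\omega\mathcal{I}$ such that for every $\phi\in{}^\omega\omega$ there is $s\in\mathcal{S}$ with $\{n:\phi(n)\in s(n)\}\in\mathcal{J}^\ast$; $\mathrm{sl}_e(\ast,\mathcal{J})$ and $\mathrm{sl}_t(\ast,\mathcal{J})$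 are defined in the same way, with ''$\mathcal{S}\subseteq{}^\omega\mathcal{I}$'' replaced by ''$\mathcal{S}\subseteq{}^\omega\mathcal{P}(\omega)$ has FUPC''. *)

(* Defs.v *)
From HB Require Import structures.
From mathcomp Require Import all_boot all_order all_algebra.
From mathcomp Require Import all_classical all_reals all_analysis.

Set Implicit Arguments.
Unset Strict Implicit.
Unset Printing Implicit Defensive.

Import Order.TTheory GRing.Theory Num.Theory.

Local Open Scope classical_set_scope.
Local Open Scope card_scope.
Local Open Scope ring_scope.

(* As in the rest of the classical library, a cardinal is represented by a set
   of that cardinality. *)
Definition card_lt (T U : Type) (A : set T) (B : set U) : Prop :=
  A #<= B /\ ~ (B #<= A).

Definition is_min_card (T : Type) (C : set (set T)) (K : set T) : Prop :=
  C K /\ forall S, C S -> K #<= S.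

(* A member of C of least cardinality; it exists as soon as C is nonempty, by
   min_cardP below. *)
Definition min_card (T : Type) (C : set (set T)) : set T :=
  xget set0 (is_min_card C).

Lemma min_cardP (T : pointedType) (C : set (set T)) :
  C !=set0 -> is_min_card C (min_card C).
Proof.
move=> [S0 CS0]; rewrite /min_card.
suff [K KP] : exists K, is_min_card C K by exact: (xgetI set0 KP).
pose P (F : set (set T -> T)) :=
  (forall f S, F f -> C S -> S (f S)) /\
  (forall f g S, F f -> F g -> C S -> f S = g S -> f = g).
have [F [[F1 F2] Fmax]] : exists F, P F /\ forall G, F `<` G -> ~ P G.
  apply: Zorn_bigcup => G GP Gtot; split.
    by move=> f S [A GA Af]; have [+ _] := GP _ GA; apply.
  move=> f g S [A GA Af] [B GB Bg]; have [AB|BA] := Gtot _ _ GA GB.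
    by have [_ +] := GP _ GB; apply => //; exact: AB.
  by have [_ +] := GP _ GA; apply => //; exact: BA.
have [K [CK KF]] : exists K, C K /\ K `<=` [set f K | f in F].
  apply: contrapT => noK.
  have /choice[h hP] S : exists x, C S -> S x /\ ~ [set f S | f in F] x.
    have [CS|nCS] := pselect (C S); last by exists point.
    have /existsNP[x /not_implyP[Sx Fx]] : ~ (S `<=` [set f S | f in F]).
      by move=> SF; apply: noK; exists S.
    by exists x.
  have nFh : ~ F h by move=> Fh; case: (hP _ CS0) => _; apply; exists h.
  apply: (Fmax (F `|` [set h])).
    by split=> [f Ff|FhF]; [left|apply/nFh/FhF; right].
  split=> [f S [Ff|->] CS|f g S [Ff|->] [Fg|->] CS fg //].
  - exact: (F1 _ _ Ff CS).
  - by case: (hP _ CS).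
  - exact: (F2 _ _ _ Ff Fg CS).
  - by case: (hP _ CS) => _ []; exists f.
  - by case: (hP _ CS) => _ []; exists g.
exists K; split => // S CS.
apply: (card_le_trans (subset_card_le KF)).
apply: (card_le_trans (card_image_le _ _)).
apply/pcard_leP/injfunPex; exists (fun f => f S) => [f Ff|f g].
  exact: (F1 _ _ Ff CS).
by rewrite !inE => Ff Fg; exact: (F2 _ _ _ Ff Fg CS).
Qed.

Record is_ideal (I : set (set nat)) : Prop := {
  ideal_sub : forall A B, A `<=` B -> I B -> I A ;
  ideal_setU : forall A B, I A -> I B -> I (A `|` B) ;
  ideal_finite : forall A, finite_set A -> I A ;
  ideal_setT : ~ I setT }.

Definition Fin : set (set nat) := [set A | finite_set A].
Definition positive (J : set (set nat)) : set (set nat) := [set A | ~ J A].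
Definition dual_filter (J : set (set nat)) : set (set nat) :=
  [set A | J (~` A)].

Definition slalom := nat -> set nat.

Definition finite_union_property (A : set (set nat)) : Prop :=
  forall D : set (set nat), finite_set D -> D `<=` A ->
    infinite_set (~` \bigcup_(a in D) a).

Definition FUPC (S : set slalom) : Prop :=
  forall n, finite_union_property [set s n | s in S].

Definition slaloms_in (I : set (set nat)) (S : set slalom) : Prop :=
  forall s, S s -> forall n, I (s n).

Definition captures (K : set (set nat)) (S : set slalom) : Prop :=
  forall phi : nat -> nat, exists2 s, S s & K [set n | s n (phi n)].

Definition sl_e (I J : set (set nat)) : set slalom :=
  min_card [set S | slaloms_in I S /\ captures (positive J) S].
Definition sl_t (I J : set (set nat)) : set slalom :=
  min_card [set S | slaloms_in I S /\ captures (dual_filter J) S].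
Definition sl_e_star (J : set (set nat)) : set slalom :=
  min_card [set S | FUPC S /\ captures (positive J) S].
Definition sl_t_star (J : set (set nat)) : set slalom :=
  min_card [set S | FUPC S /\ captures (dual_filter J) S].

(* The four minima are attained: the slaloms with singleton values capture
   every function. *)
Definition singletons : set slalom :=
  [set s | exists phi : nat -> nat, s = fun n => [set phi n]].

Lemma singletons_captures (K : set (set nat)) : K setT -> captures K singletons.
Proof.
move=> KT phi; exists (fun n => [set phi n]); first by exists phi.
by rewrite (_ : [set n | _] = setT)//; apply/seteqP; split.
Qed.

Lemma singletons_in (I : set (set nat)) : is_ideal I -> slaloms_in I singletons.
Proof. by move=> iI s [phi ->] n; exact/(ideal_finite iI)/finite_set1. Qed.

Lemma singletons_FUPC : FUPC singletons.
Proof.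
move=> n D finD Dn finC.
have : finite_set [set: nat].
  rewrite -(setUv (\bigcup_(a in D) a)) finite_setU; split => //.
  apply: bigcup_finite => // a /Dn[s [phi ->] <-]; exact: finite_set1.
exact: infinite_nat.
Qed.

Lemma positiveT J : is_ideal J -> positive J setT.
Proof. exact: ideal_setT. Qed.

Lemma dual_filterT J : is_ideal J -> dual_filter J setT.
Proof.
by move=> iJ; rewrite /dual_filter /= setCT; exact: (ideal_finite iJ).
Qed.

Lemma sl_eP I J : is_ideal I -> is_ideal J ->
  is_min_card [set S | slaloms_in I S /\ captures (positive J) S] (sl_e I J).
Proof.
move=> iI iJ; apply: min_cardP; exists singletons; split.
  exact: singletons_in.
by apply: singletons_captures; exact: positiveT.
Qed.

Lemma sl_tP I J : is_ideal I -> is_ideal J ->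
  is_min_card [set S | slaloms_in I S /\ captures (dual_filter J) S]
    (sl_t I J).
Proof.
move=> iI iJ; apply: min_cardP; exists singletons; split.
  exact: singletons_in.
by apply: singletons_captures; exact: dual_filterT.
Qed.

Lemma sl_e_starP J : is_ideal J ->
  is_min_card [set S | FUPC S /\ captures (positive J) S] (sl_e_star J).
Proof.
move=> iJ; apply: min_cardP; exists singletons; split.
  exact: singletons_FUPC.
by apply: singletons_captures; exact: positiveT.
Qed.

Lemma sl_t_starP J : is_ideal J ->
  is_min_card [set S | FUPC S /\ captures (dual_filter J) S] (sl_t_star J).
Proof.
move=> iJ; apply: min_cardP; exists singletons; split.
  exact: singletons_FUPC.
by apply: singletons_captures; exact: dual_filterT.
Qed.

Record is_bornology (X : Type) (BB : set (set X)) : Prop := {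
  bornology_sub : forall A B, A `<=` B -> BB B -> BB A ;
  bornology_setU : forall A B, BB A -> BB B -> BB (A `|` B) ;
  bornology_cover : \bigcup_(B in BB) B = setT }.

Definition closed_base (X : topologicalType) (BB BB0 : set (set X)) : Prop :=
  [/\ BB0 `<=` BB,
      forall B, BB B -> exists2 B0, BB0 B0 & B `<=` B0 &
      forall B, BB0 B -> closed B].

Definition proper_cover (X : Type) (U : set (set X)) : Prop :=
  ~ U setT /\ \bigcup_(V in U) V = setT.

Section Covers.
Context {R : realType} {X : metricType R}.
Implicit Types (BB U : set (set X)) (B : set X).

Definition enlarge B (delta : R) : set X :=
  \bigcup_(x in B) [set y | mdist x y < delta].

Definition Bs_cover BB U : Prop :=
  proper_cover U /\
  forall B, BB B -> exists V, U V /\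
    exists2 delta : R, 0 < delta & enlarge B delta `<=` V.

Definition open_Bs_covers BB : set (set (set X)) :=
  [set U | Bs_cover BB U /\ forall V, U V -> open V].

Definition Bs_Lindelof BB : Prop :=
  forall U, Bs_cover BB U ->
    exists U', [/\ U' `<=` U, countable U' & Bs_cover BB U'].

(* Repetitions in the enumeration u are allowed. *)
Definition gamma_Bs_covers (I : set (set nat)) BB : set (nat -> set X) :=
  [set u | [/\ proper_cover (range u),
      forall n, open (u n) &
      forall B, BB B -> exists delta : nat -> R,
        (forall n, 0 < delta n) /\
        I [set n | ~ (enlarge B (delta n) `<=` u n)]]].

End Covers.

(* The selections are sequences, since membership of the selected cover in an
   ideal-gamma class depends on its enumeration.  The next two definitions pass
   between classes of enumerated families and classes of families. *)
Definition S1 (T : Type) (A : set (set T)) (C : set (nat -> T)) : Prop :=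
  forall F : nat -> set T, (forall n, A (F n)) ->
    exists a : nat -> T, (forall n, F n (a n)) /\ C a.

Definition ranges (T : Type) (C : set (nat -> T)) : set (set T) :=
  [set range u | u in C].
Definition enumerations (T : Type) (A : set (set T)) : set (nat -> T) :=
  [set u | A (range u)].

(* Main.v *)
Require Import Defs.
From mathcomp Require Import all_boot all_order all_algebra.
From mathcomp Require Import all_classical all_reals all_analysis.

Local Open Scope classical_set_scope.

(** Suppose that sets [u n m], for [m] in nat, are the candidates for the
[n]-th selection.  Each member [B] of the base yields a slalom, whose value at
[n] is the set of the indices [m] that are bad for [B]: no uniform enlargement
of [B] lies in [u n m].  There are at most [#|BB0|] such slaloms, fewer than
the slalom number of each part, so they cannot capture every function: some
[phi] is captured by none of them ([small_family_evaded]).  The selection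
[n |-> u n (phi n)] is then good for every [B] in the base, as often as the
slalom number at hand guarantees: for all [n] up to a set of [J] for [sl_e]
([nonpositive_gamma]), for infinitely many [n], hence for one, for [sl_t]
([nondual_open_Bs]).

It remains to see that the slaloms are of the kind that the slalom number
quantifies over.  For an ideal-gamma cover in its own enumeration, being bad
for [B] happens on a set of [I] by definition ([gamma_enumeration]).  An open
cover of a Lindelof space is first thinned out to a countable one, then
enumerated with every element repeated infinitely often.  The union of finitely
many members of the base lies uniformly inside some element of the cover, and
the infinitely many indices of this element are good for all of them: this is
the finite union property ([open_Bs_enumeration]). *)

(** If no function escaped the slaloms indexed by [A], they would form a
competitor in the definition of the minimum [M], of cardinality at most that
of [A]. *)
Lemma small_family_evaded {T : Type} {A : set T} {s : T -> slalom}
    {P : set slalom -> Prop} {K : set (set nat)} {M : set slalom} :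
  is_min_card [set S | P S /\ captures K S] M -> card_lt A M ->
  P (s @` A) ->
  exists phi : nat -> nat, forall x, A x -> ~ K [set n | s x n (phi n)].
Proof.
move=> [_ minM] [_ nMA] Ps; apply: contrapT => noevade; apply: nMA.
apply: card_le_trans (card_image_le s A); apply: minM; split => // phi.
apply: contrapT => nocapt; apply: noevade; exists phi => x Ax Kx.
by apply: nocapt; exists (s x) => //; exists x.
Qed.

(** Pairing indices spreads each value of a given enumeration over infinitely
many indices. *)
Lemma repeating_enumeration {T : Type} {U : set T} :
  countable U -> U !=set0 ->
  exists2 u : nat -> T, (forall m, U (u m)) &
    forall V, U V -> infinite_set [set m | u m = V].
Proof.
move=> /countable_injP[f finj] [V0 UV0].
have /choice[g gP] i : exists V, U V /\ forall W, U W -> f W = i -> V = W.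
  have [[V [UV fV]]|noV] := pselect (exists V, U V /\ f V = i).
    by exists V; split=> // W UW fW; apply: finj; rewrite ?inE// fW fV.
  by exists V0; split=> // W UW fW; case: noV; exists W.
pose p m : nat * nat := odflt (0, 0) (unpickle m).
exists (fun m => g (p m).1) => [m|V UV]; first by case: (gP (p m).1).
move=> fin.
(* The indices coding the pairs [(f V, j)] all carry the value [V]. *)
have inj : injective (fun j : nat => pickle (f V, j)).
  by move=> i j /(pcan_inj pickleK)[].
have := finite_preimage (in2W inj) fin.
rewrite (_ : _ @^-1` _ = setT); first exact: infinite_nat.
apply/seteqP; split=> // j _ /=.
by rewrite /p pickleK /=; case: (gP (f V)) => _; apply.
Qed.

Section Selection.
Context {R : realType} {X : metricType R} {BB BB0 : set (set X)}.
Context (hBB : is_bornology BB) (hBB0 : closed_base BB BB0).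
Implicit Types (B V : set X) (u : nat -> set X).

Definition uniformly_inside B V : Prop :=
  exists2 delta : R, (0 < delta)%R & enlarge B delta `<=` V.

Definition bad_indices u B : set nat := [set m | ~ uniformly_inside B (u m)].

Lemma uniformly_inside_sub B V : uniformly_inside B V -> B `<=` V.
Proof. by move=> [d d0 BV] x Bx; apply: BV; exists x; rewrite //= mdistxx. Qed.

Lemma uniformly_insideW B B' V : B `<=` B' ->
  uniformly_inside B' V -> uniformly_inside B V.
Proof.
move=> sub [d d0 BV]; exists d => // y [x Bx xy].
by apply: BV; exists x => //; exact: sub.
Qed.

Lemma bad_indices_mono u B B' : B `<=` B' ->
  bad_indices u B `<=` bad_indices u B'.
Proof. by move=> sub m; apply: contra_not; exact: uniformly_insideW. Qed.

(** The radii in an ideal-gamma cover may depend on the index, so they can be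
chosen one index at a time. *)
Lemma gamma_bad_indicesP {I : set (set nat)} {u B} : is_ideal I ->
  (exists delta : nat -> R, (forall n, (0 < delta n)%R) /\
     I [set n | ~ (enlarge B (delta n) `<=` u n)]) <-> I (bad_indices u B).
Proof.
move=> hI; split=> [[d [d0 Id]]|Ibad].
  apply: (ideal_sub hI) Id => n; apply: contra_not => le.
  by exists (d n).
have /choice[d dP] n : exists d : R, (0 < d)%R /\
    (uniformly_inside B (u n) -> enlarge B d `<=` u n).
  have [[d d0 dB]|no] := pselect (uniformly_inside B (u n)); first by exists d.
  by exists 1%R.
exists d; split=> [n|]; first by case: (dP n).
by apply: (ideal_sub hI) Ibad => n; apply: contra_not; case: (dP n).
Qed.

Lemma bornology1 x : BB [set x].
Proof.
have [B BBB Bx] : (\bigcup_(B in BB) B) x by rewrite (bornology_cover hBB).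
by apply: (bornology_sub hBB) BBB => _ ->.
Qed.

Lemma proper_cover_uniform (U : set (set X)) : ~ U setT ->
  (forall B, BB B -> exists2 V, U V & uniformly_inside B V) -> proper_cover U.
Proof.
move=> nU UB; split=> //; apply/seteqP; split=> // x _.
have [V UV /uniformly_inside_sub sub] := UB _ (bornology1 x).
by exists V => //; exact: sub.
Qed.

(** A union of members of the bornology is again one, so a finite union of
sets of bad indices is contained in a single such set. *)
Lemma finite_bad_indices u (D : set (set nat)) : BB !=set0 ->
  finite_set D -> D `<=` [set bad_indices u B | B in BB0] ->
  exists2 B, BB B & \bigcup_(a in D) a `<=` bad_indices u B.
Proof.
move=> [B0 BBB0] /finite_seqP[s ->]; elim: s => [|a s IHs] sub.
  by exists B0 => // m [].
have [|B BBB Bs] := IHs; first by move=> b bs; apply: sub; rewrite /= inE bs orbT.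
have [B' B0B' aE] := sub a (mem_head _ _).
have BBB' : BB B' by case: hBB0 => + _ _; exact.
exists (B `|` B'); first exact: (bornology_setU hBB).
move=> m [b /=]; rewrite inE => /orP[/eqP -> |bs] bm.
  by apply: (@bad_indices_mono u B') => [x|]; [right|rewrite aE].
by apply: (@bad_indices_mono u B) => [x|]; [left|apply: Bs; exists b].
Qed.

Lemma gamma_enumeration {I : set (set nat)} {U : set (set X)} : is_ideal I ->
  ranges (gamma_Bs_covers I BB) U ->
  exists2 u, (forall m, U (u m)) & forall B, BB0 B -> I (bad_indices u B).
Proof.
move=> hI [u [_ _ uI] <-]; exists u => [m|B B0B]; first by exists m.
apply/(gamma_bad_indicesP hI)/uI.
by case: hBB0 => + _ _; exact.
Qed.

Lemma open_Bs_enumeration {U : set (set X)} : [set: X] !=set0 ->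
  Bs_Lindelof BB -> open_Bs_covers BB U ->
  exists2 u, (forall m, U (u m)) &
    finite_union_property [set bad_indices u B | B in BB0].
Proof.
move=> [x _] lind [/lind[U' [U'U cU' [_ U'B]]] _].
have BBn0 : BB !=set0 by exists [set x]; exact: bornology1.
have [|u uU' urep] := repeating_enumeration cU'.
  by have [V [U'V _]] := U'B _ (bornology1 x); exists V.
exists u => [m|D finD subD]; first exact/U'U/uU'.
have [B BBB Dbad] := finite_bad_indices _ _ BBn0 finD subD.
have [V [U'V BV]] := U'B _ BBB.
apply: contra_not (urep _ U'V); apply: sub_finite_set => m /= uV /Dbad.
by apply; rewrite uV.
Qed.

(** That the selection covers the points of [X] is not automatic: it holds
because a proper ideal does not contain nat, so every singleton is good for
some index. *)
Lemma nonpositive_gamma {J : set (set nat)} {a : nat -> set X} : is_ideal J ->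
  (forall n, open (a n)) -> ~ range a setT ->
  (forall B, BB0 B -> ~ positive J (bad_indices a B)) -> gamma_Bs_covers J BB a.
Proof.
move=> hJ aopen anT aB.
have Jbad B : BB B -> J (bad_indices a B).
  move=> BBB; case: hBB0 => _ /(_ _ BBB)[B0 B0B0 BB0'] _.
  apply: (ideal_sub hJ); first exact: bad_indices_mono BB0'.
  exact: contrapT (aB _ B0B0).
split=> // [|B /Jbad]; last by rewrite gamma_bad_indicesP.
apply: proper_cover_uniform => // B /Jbad Jb; apply: contrapT => no.
apply: (ideal_setT hJ); apply: (ideal_sub hJ) Jb => n _ aBn.
by apply: no; exists (a n) => //; exists n.
Qed.

(** A set whose complement is infinite is not all of nat, so every member of
the bornology has an index that is not bad; one such index is enough. *)
Lemma nondual_open_Bs {a : nat -> set X} :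
  (forall n, open (a n)) -> ~ range a setT ->
  (forall B, BB0 B -> ~ dual_filter Fin (bad_indices a B)) ->
  enumerations (open_Bs_covers BB) a.
Proof.
move=> aopen anT aB.
have aUI B : BB B -> exists2 V, range a V & uniformly_inside B V.
  move=> BBB; case: hBB0 => _ /(_ _ BBB)[B0 B0B0 BB0'] _.
  apply: contrapT => no; apply: (aB _ B0B0).
  suff -> : bad_indices a B0 = setT.
    by rewrite /dual_filter /Fin /= setCT; exact: finite_set0.
  apply/seteqP; split=> // n _ /(uniformly_insideW _ _ _ BB0') aBn.
  by apply: no; exists (a n) => //; exists n.
split; last by move=> _ [n _ <-].
split; first exact: proper_cover_uniform.
by move=> B /aUI[V aV BV]; exists V.
Qed.

(** The four selection principles differ only in how the source covers are
enumerated and in what escaping the slaloms says about the selection; this is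
the argument that they share.  [Q] is what makes the bad indices of an enumeration suitable as the values
of the slaloms in [P]. *)
Lemma S1_of_slaloms (A : set (set (set X))) (C : set (nat -> set X))
    (Q : (nat -> set X) -> Prop)
    (P : set slalom -> Prop) (K : set (set nat)) (M : set slalom) :
  is_min_card [set S | P S /\ captures K S] M -> card_lt BB0 M ->
  (forall U, A U -> ~ U setT /\ forall V, U V -> open V) ->
  (forall U, A U -> exists2 u, (forall m, U (u m)) & Q u) ->
  (forall u : nat -> nat -> set X, (forall n, Q (u n)) ->
     P [set (fun n => bad_indices (u n) B) | B in BB0]) ->
  (forall a : nat -> set X, (forall n, open (a n)) -> ~ range a setT ->
     (forall B, BB0 B -> ~ K (bad_indices a B)) -> C a) ->
  S1 A C.
Proof.
move=> minM ltM Aopen Aenum QP KC F AF.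
have /choice[u uP] n : exists u, (forall m, F n (u m)) /\ Q u.
  by have [u uF Qu] := Aenum _ (AF n); exists u.
have uF n m : F n (u n m) by case: (uP n).
have [phi phiP] := small_family_evaded minM ltM
  (QP u (fun n => proj2 (uP n))).
exists (fun n => u n (phi n)); split=> //; apply: KC => //.
  by move=> n; have [_] := Aopen _ (AF n); exact.
by move=> [n _ uT]; have [+ _] := Aopen _ (AF n); apply; rewrite -uT.
Qed.

Lemma gamma_members {I : set (set nat)} {U : set (set X)} :
  ranges (gamma_Bs_covers I BB) U -> ~ U setT /\ forall V, U V -> open V.
Proof. by move=> [u [[nT _] uopen _] <-]; split=> // _ [n _ <-]. Qed.

Lemma open_Bs_members {U : set (set X)} :
  open_Bs_covers BB U -> ~ U setT /\ forall V, U V -> open V.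
Proof. by move=> [[[nT _] _] Uopen]. Qed.

Lemma bad_slaloms_in (I : set (set nat)) (u : nat -> nat -> set X) :
  (forall n B, BB0 B -> I (bad_indices (u n) B)) ->
  slaloms_in I [set (fun n => bad_indices (u n) B) | B in BB0].
Proof. by move=> uI _ [B B0B <-] n; exact: uI. Qed.

Lemma bad_slaloms_FUPC (u : nat -> nat -> set X) :
  (forall n, finite_union_property [set bad_indices (u n) B | B in BB0]) ->
  FUPC [set (fun n => bad_indices (u n) B) | B in BB0].
Proof.
move=> fup n D finD subD; apply: (fup n) => // a /subD[_ [B B0B <-] <-].
by exists B.
Qed.

End Selection.

Theorem theorem3p4 (R : realType) (X : metricType R)
    (BB BB0 : set (set X)) (I J : set (set nat))
    (infX : infinite_set [set: X])
    (hBB : is_bornology BB) (hBB0 : closed_base BB BB0)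
    (hI : is_ideal I) (hJ : is_ideal J) :
  [/\ card_lt BB0 (sl_e I J) ->
        S1 (ranges (gamma_Bs_covers I BB)) (gamma_Bs_covers J BB),
      card_lt BB0 (sl_e_star J) -> Bs_Lindelof BB ->
        S1 (open_Bs_covers BB) (gamma_Bs_covers J BB),
      card_lt BB0 (sl_t I Fin) ->
        S1 (ranges (gamma_Bs_covers I BB)) (enumerations (open_Bs_covers BB)) &
      card_lt BB0 (sl_t_star Fin) -> Bs_Lindelof BB ->
        S1 (open_Bs_covers BB) (enumerations (open_Bs_covers BB))].
Proof.
have hFin : is_ideal Fin.
  split=> [A B|A B fA fB|//|]; first exact: sub_finite_set.
    by rewrite /Fin /= finite_setU.
  exact: infinite_nat.
have X0 : [set: X] !=set0 by exact: infinite_setN0.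
split=> [lt|lt lind|lt|lt lind].
- apply: (S1_of_slaloms _ _ _ _ _ _ (sl_eP hI hJ) lt
    (@gamma_members _ _ _ _) (fun U => gamma_enumeration hBB0 hI)).
    by move=> u; exact: bad_slaloms_in.
  by move=> a; exact: nonpositive_gamma.
- apply: (S1_of_slaloms _ _ _ _ _ _ (sl_e_starP hJ) lt
    (@open_Bs_members _ _ _)
    (fun U => open_Bs_enumeration hBB hBB0 X0 lind)).
    exact: bad_slaloms_FUPC.
  by move=> a; exact: nonpositive_gamma.
- apply: (S1_of_slaloms _ _ _ _ _ _ (sl_tP hI hFin) lt
    (@gamma_members _ _ _ _) (fun U => gamma_enumeration hBB0 hI)).
    by move=> u; exact: bad_slaloms_in.
  by move=> a; exact: nondual_open_Bs.
- apply: (S1_of_slaloms _ _ _ _ _ _ (sl_t_starP hFin) lt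
    (@open_Bs_members _ _ _)
    (fun U => open_Bs_enumeration hBB hBB0 X0 lind)).
    exact: bad_slaloms_FUPC.
  by move=> a; exact: nondual_open_Bs.
Qed.
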